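(* Let $R$ be a ring and $A$ a right ideal of $R$. Let $A=A_1\cdots A_n$ and $A=B_1\cdots B_m$ be two serial factorizations of $A$. Then $n=m$ and there exists a unique permutation $\sigma$ of $\{1,\dots,n\}$ such that $A_i=B_{\sigma(i)}$ for every $i=1,\dots,n$. Moreover, when $n\ge 2$, all the right ideals $A_i$ and the right ideal $A$ are two-sided, and the factor ring $R/A$ is canonically isomorphic to the ring direct product $R/A_1\times\cdots\times R/A_n$ (via $r+A\mapsto (r+A_1,\dots,r+A_n)$), with all the rings $R/A_i$ right chain rings.
   Context: Rings are associative with identity $1\neq 0$, not necessarily commutative. The product $IJ$ of two right ideals is the set of finite sums of products $xy$ with $x\in I$, $y\in J$. A right module is uniserial if its lattice of submodules is linearly ordered by inclusion. A right chain ring is a ring $R$ such that the right module $R_R$ is uniserial. A finite family $\{A_1,\dots,A_n\}$ of proper right ideals of $R$ is coindependent if $A_i+\bigcap_{j\neq i}A_j=R$ for every $i$ (an empty intersection being $R$). A serial factorization of a right ideal $A$ of $R$ is a factorization $A=A_1\cdots A_n$ where $A_1,\dots,A_n$ are proper right ideals of $R$ forming a coindependent family, $A_iA_j=A_jA_i$ for all $i,j$, and $R/A_i$ is a uniserial right $R$-module for every $i$. The improper ideal $R$ is regarded as having the empty serial factorization ($n=0$). *)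

(* Defs.v *)
From HB Require Import structures.
From mathcomp Require Import all_boot all_order all_algebra perm.
From mathcomp Require Import boolp classical_sets.

Set Implicit Arguments.
Unset Strict Implicit.
Unset Printing Implicit Defensive.

Import GRing.Theory.
Local Open Scope ring_scope.
Local Open Scope quotient_scope.
Local Open Scope classical_set_scope.

(* A right R-module is a module over the converse ring, i.e. an lmodType R^c;
   R itself, as a right R-module, is the regular module R^c^o, on which
   a *: x is the product x * a computed in R. The pitfall of this encoding is
   that * on R^c and R^c^o is the reversed product, so every product of
   elements below is taken at type R. Submodules are the library's
   submodClosed, whose membership is boolean; as excluded middle is available
   through boolp, these are all the submodules. *)

Definition uniserial (S : pzRingType) (M : lmodType S) : Prop :=
  forall N P : submodClosed M, {subset N <= P} \/ {subset P <= N}.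

Section QuotientModule.
Variables (S : pzRingType) (M : lmodType S) (N : submodClosed M).

Definition submod_mem : {pred M} := fun x => x \in N.

Fact submod_mem_zmod : zmod_closed submod_mem.
Proof. exact: (GRing.submod_closedB (submodClosedP N)). Qed.

HB.instance Definition _ := GRing.isZmodClosed.Build M submod_mem submod_mem_zmod.

Definition quotmod : Type := {ideal_quot submod_mem}.

HB.instance Definition _ := GRing.Zmodule.on quotmod.
HB.instance Definition _ := Quotient.on quotmod.

Definition quotmod_scale (a : S) : quotmod -> quotmod :=
  lift_op1 quotmod ( *:%R a).

Fact quotmodP (x y : M) : reflect (\pi_quotmod x = \pi_quotmod y) (x - y \in N).
Proof.
have -> : (x - y \in N) = (x == y %[mod {ideal_quot submod_mem}]).
  by rewrite -Quotient.idealrBE.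
exact: eqP.
Qed.

Fact pi_quotmodD (x y : M) :
  \pi_quotmod (x + y) = \pi_quotmod x + \pi_quotmod y :> quotmod.
Proof. exact: (raddfD (\pi_{ideal_quot submod_mem})). Qed.

Fact pi_quotmodZ a (x : M) : \pi_quotmod (a *: x) = quotmod_scale a (\pi_quotmod x).
Proof.
unlock quotmod_scale; apply/quotmodP; rewrite -scalerBr; apply: rpredZ.
exact/quotmodP/esym/reprK.
Qed.

Fact quotmod_scaleA a b u :
  quotmod_scale a (quotmod_scale b u) = quotmod_scale (a * b) u.
Proof. by elim/quotW: u => x; rewrite -!pi_quotmodZ scalerA. Qed.

Fact quotmod_scale1 : left_id 1 quotmod_scale.
Proof. by elim/quotW => x; rewrite -pi_quotmodZ scale1r. Qed.

Fact quotmod_scaleDr : right_distributive quotmod_scale +%R.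
Proof.
move=> a; elim/quotW => x; elim/quotW => y.
by rewrite -pi_quotmodD -!pi_quotmodZ scalerDr pi_quotmodD.
Qed.

Fact quotmod_scaleDl u : {morph quotmod_scale^~ u : a b / a + b}.
Proof.
by elim/quotW: u => x a b /=; rewrite -!pi_quotmodZ scalerDl pi_quotmodD.
Qed.

HB.instance Definition _ := GRing.Zmodule_isLmodule.Build S quotmod
  quotmod_scaleA quotmod_scale1 quotmod_scaleDr quotmod_scaleDl.

End QuotientModule.

Definition rideal (R : pzRingType) : Type := submodClosed R^c^o.

Definition rideal_set (R : pzRingType) (I : rideal R) : set R :=
  [set x : R | (x : R^c^o) \in I].
Coercion rideal_set : rideal >-> set.

Definition two_sided (R : pzRingType) (I : rideal R) : Prop :=
  forall a x : R, (I : set R) x -> (I : set R) (a * x).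

Definition set_mul (R : pzRingType) (X Y : set R) : set R :=
  [set z | exists2 s : seq (R * R),
     forall p, p \in s -> X p.1 /\ Y p.2 & z = \sum_(p <- s) p.1 * p.2].

Section QuotientRing.
Variables (R : pzRingType) (I : rideal R) (I2 : two_sided I).

(* The additive group is that of the right module R/I; the proof argument only
   serves to attach the ring structure. *)
Definition quotring of two_sided I : Type := quotmod I.
Local Notation Q := (quotring I2).

HB.instance Definition _ := GRing.Zmodule.on Q.
HB.instance Definition _ := Quotient.on Q.

Definition quotring_one : Q := \pi_Q (1 : R).
Definition quotring_mul : Q -> Q -> Q := lift_op2 Q (@GRing.mul R).

Fact quotringP (x y : R) : reflect (\pi_Q x = \pi_Q y) ((x - y : R^c^o) \in I).
Proof. exact: (quotmodP I x y). Qed.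

Fact pi_quotringD (x y : R) : \pi_Q (x + y) = \pi_Q x + \pi_Q y :> Q.
Proof. exact: (pi_quotmodD I x y). Qed.

Fact pi_quotringM (x y : R) : \pi_Q (x * y) = quotring_mul (\pi_Q x) (\pi_Q y).
Proof.
have repr_mod (z : R) : ((z - repr (\pi_Q z) : R) : R^c^o) \in I.
  exact/quotringP/esym/reprK.
unlock quotring_mul; apply/quotringP; rewrite -[x * y](subrK (x * (repr (\pi_Q y) : R))) -addrA.
rewrite -mulrBr -mulrBl; apply: (@rpredD _ (I : submodClosed R^c^o)).
  exact: I2 (repr_mod y).
exact: (@rpredZ R^c R^c^o I (repr (\pi_Q y)) _ (repr_mod x)).
Qed.

Fact quotring_mulA : associative quotring_mul.
Proof.
elim/quotW => x; elim/quotW => y; elim/quotW => z.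
by rewrite -!pi_quotringM mulrA.
Qed.

Fact quotring_mul1 : left_id quotring_one quotring_mul.
Proof. by elim/quotW => x; rewrite -pi_quotringM mul1r. Qed.

Fact quotring_mulr1 : right_id quotring_one quotring_mul.
Proof. by elim/quotW => x; rewrite -pi_quotringM mulr1. Qed.

Fact quotring_mulDl : left_distributive quotring_mul +%R.
Proof.
elim/quotW => x; elim/quotW => y; elim/quotW => z.
by rewrite -pi_quotringD -!pi_quotringM mulrDl pi_quotringD.
Qed.

Fact quotring_mulDr : right_distributive quotring_mul +%R.
Proof.
elim/quotW => x; elim/quotW => y; elim/quotW => z.
by rewrite -pi_quotringD -!pi_quotringM mulrDr pi_quotringD.
Qed.

HB.instance Definition _ := GRing.Zmodule_isPzRing.Build Q
  quotring_mulA quotring_mul1 quotring_mulr1 quotring_mulDl quotring_mulDr.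

End QuotientRing.

Section DirectProduct.
Variables (J : finType) (T : J -> pzRingType).

Definition ring_prod : Type := {dffun forall j : J, T j}.

HB.instance Definition _ := Choice.on ring_prod.

Implicit Types f g h : ring_prod.

Definition ring_prod_zero : ring_prod := [ffun j => 0 : T j].
Definition ring_prod_one : ring_prod := [ffun j => 1 : T j].
Definition ring_prod_opp f : ring_prod := [ffun j => - f j].
Definition ring_prod_add f g : ring_prod := [ffun j => f j + g j].
Definition ring_prod_mul f g : ring_prod := [ffun j => f j * g j].

Fact ring_prod_addA : associative ring_prod_add.
Proof. by move=> f g h; apply/ffunP => j; rewrite !ffunE addrA. Qed.

Fact ring_prod_addC : commutative ring_prod_add.
Proof. by move=> f g; apply/ffunP => j; rewrite !ffunE addrC. Qed.

Fact ring_prod_add0 : left_id ring_prod_zero ring_prod_add.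
Proof. by move=> f; apply/ffunP => j; rewrite !ffunE add0r. Qed.

Fact ring_prod_addN : left_inverse ring_prod_zero ring_prod_opp ring_prod_add.
Proof. by move=> f; apply/ffunP => j; rewrite !ffunE addNr. Qed.

HB.instance Definition _ := GRing.isZmodule.Build ring_prod
  ring_prod_addA ring_prod_addC ring_prod_add0 ring_prod_addN.

Fact ring_prod_mulA : associative ring_prod_mul.
Proof. by move=> f g h; apply/ffunP => j; rewrite !ffunE mulrA. Qed.

Fact ring_prod_mul1 : left_id ring_prod_one ring_prod_mul.
Proof. by move=> f; apply/ffunP => j; rewrite !ffunE mul1r. Qed.

Fact ring_prod_mulr1 : right_id ring_prod_one ring_prod_mul.
Proof. by move=> f; apply/ffunP => j; rewrite !ffunE mulr1. Qed.

Fact ring_prod_mulDl : left_distributive ring_prod_mul +%R.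
Proof. by move=> f g h; apply/ffunP => j; rewrite !ffunE mulrDl. Qed.

Fact ring_prod_mulDr : right_distributive ring_prod_mul +%R.
Proof. by move=> f g h; apply/ffunP => j; rewrite !ffunE mulrDr. Qed.

HB.instance Definition _ := GRing.Zmodule_isPzRing.Build ring_prod
  ring_prod_mulA ring_prod_mul1 ring_prod_mulr1 ring_prod_mulDl ring_prod_mulDr.

End DirectProduct.

(* Rings have 1 <> 0, which a pzRingType does not ensure. *)
Definition right_chain_ring (R : pzRingType) : Prop :=
  (1 : R) <> 0 /\ uniserial R^c^o.

Definition coindependent (R : pzRingType) (n : nat) (A_ : 'I_n -> rideal R) :
    Prop :=
  (forall i, (A_ i : set R) <> setT) /\
  (forall i, [set x + y | x in (A_ i : set R)
                        & y in \bigcap_(j in [set j | j <> i]) (A_ j : set R)]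
             = setT).

(* The iterated product is A_0 (A_1 (... (A_(n-1) R))); the trailing factor R
   is harmless since A_(n-1) R = A_(n-1), and it gives R when n = 0. *)
Definition serial_factorization (R : pzRingType) (A : rideal R) (n : nat)
    (A_ : 'I_n -> rideal R) : Prop :=
  [/\ (A : set R) = \big[@set_mul R/setT]_(i < n) (A_ i : set R),
      coindependent A_,
      forall i j, set_mul (A_ i) (A_ j) = set_mul (A_ j) (A_ i)
    & forall i, uniserial (quotmod (A_ i))].

(* Main.v *)
(* Commuting comaximal right ideals are two-sided, since
   RI = (J + I)I is contained in JI + I = IJ + I = I; hence for n >= 2 all the
   A_i are two-sided, and A is their intersection.  The right ideals above A_i
   form a chain, and A_i + B_j is proper for some j because otherwise A_i would
   be comaximal with the intersection A of the B_j.  Two distinct B_j cannot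
   both give a proper sum, so A_i is comaximal with the intersection of the
   other ones, which forces B_j inside A_i.  By symmetry B_j contains some A_k,
   and k = i by coindependence. *)
Require Import Defs.
From HB Require Import structures.
From mathcomp Require Import all_boot all_order all_algebra perm.
From mathcomp Require Import boolp classical_sets.

Set Implicit Arguments.
Unset Strict Implicit.
Unset Printing Implicit Defensive.

Import GRing.Theory.
Local Open Scope ring_scope.
Local Open Scope quotient_scope.
Local Open Scope classical_set_scope.

(** Excluded middle turns a set into a boolean predicate, so sums, images and preimages can be
    bundled as submodules. Opposites come for free, being multiples by -1. *)
Lemma submod_of_set (S : pzRingType) (M : lmodType S) (X : set M) :
    X 0 -> (forall x y, X x -> X y -> X (x + y)) ->
    (forall a x, X x -> X (a *: x)) ->
  exists N : submodClosed M, forall x, x \in N <-> X x.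
Proof.
move=> X0 XD XZ; pose P : {pred M} := fun x => `[<X x>].
have clP : GRing.subsemimod_closed P.
  split; first split; first exact/asboolP.
    by move=> x y /asboolP Xx /asboolP Xy; apply/asboolP/XD.
  by move=> a x /asboolP Xx; apply/asboolP/XZ.
pose N : submodClosed M := HB.pack P (GRing.isSubSemiModClosed.Build _ _ P clP).
by exists N => x; split=> [/asboolP|Xx] //; apply/asboolP.
Qed.

(** * Products and comaximality of right ideals *)

Section RightIdeals.
Variable R : pzRingType.
Implicit Types (X Y Z : set R) (I J C : rideal R).

Lemma rideal0 I : (I : set R) 0.
Proof. exact: (rpred0 I). Qed.

Lemma ridealD I (x y : R) : (I : set R) x -> (I : set R) y -> (I : set R) (x + y).
Proof. exact: (@rpredD _ I). Qed.

Lemma ridealM I (x a : R) : (I : set R) x -> (I : set R) (x * a).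
Proof. exact: (@rpredZ R^c R^c^o I a). Qed.

Lemma ridealN I (x : R) : (I : set R) x -> (I : set R) (- x).
Proof. by rewrite -mulrN1; apply: ridealM. Qed.

Lemma rideal_setT I : (I : set R) 1 -> (I : set R) = setT.
Proof. by move=> I1; apply/seteqP; split=> x // _; rewrite -[x]mul1r; apply: ridealM. Qed.

Lemma set_mul_in X Y x y : X x -> Y y -> set_mul X Y (x * y).
Proof.
by move=> Xx Yy; exists [:: (x, y)]; [move=> p /[!inE] /eqP-> | rewrite big_seq1].
Qed.

Lemma set_mul0 X Y : set_mul X Y 0.
Proof. by exists [::]; rewrite ?big_nil. Qed.

Lemma set_mulD X Y u v : set_mul X Y u -> set_mul X Y v -> set_mul X Y (u + v).
Proof.
move=> [s sXY ->] [t tXY ->]; exists (s ++ t); last by rewrite big_cat.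
by move=> p; rewrite mem_cat => /orP[/sXY|/tXY].
Qed.

Lemma set_mul_min X Y Z :
    Z 0 -> (forall u v, Z u -> Z v -> Z (u + v)) ->
    (forall x y, X x -> Y y -> Z (x * y)) ->
  set_mul X Y `<=` Z.
Proof.
move=> Z0 ZD ZM z [s sXY ->]; rewrite big_seq.
by apply: big_ind => // p /sXY[]; apply: ZM.
Qed.

Lemma set_mulS X Y X' Y' : X `<=` X' -> Y `<=` Y' -> set_mul X Y `<=` set_mul X' Y'.
Proof.
move=> sX sY; apply: set_mul_min => [|u v|x y /sX X'x /sY Y'y].
- exact: set_mul0.
- exact: set_mulD.
- exact: set_mul_in.
Qed.

Lemma set_mulA : associative (@set_mul R).
Proof.
move=> X Y Z; apply/seteqP; split; apply: set_mul_min;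
  [exact: set_mul0 | exact: set_mulD | | exact: set_mul0 | exact: set_mulD | ].
(* For fixed [x], the elements whose product with [x] lies in the target are closed under sums, so
   the inner factor reduces to a single product as well. *)
- move=> x u Xx; move: u; apply: set_mul_min => [|u v|y z Yy Zz].
  + by rewrite mulr0; apply: set_mul0.
  + by rewrite mulrDr; apply: set_mulD.
  + by rewrite mulrA; do 2?apply: set_mul_in.
- move=> u z + Zz; move: u; apply: set_mul_min => [|u v|x y Xx Yy].
  + by rewrite mul0r; apply: set_mul0.
  + by rewrite mulrDl; apply: set_mulD.
  + by rewrite -mulrA; do 2?apply: set_mul_in.
Qed.

Lemma set_mul_ridealS I Y : set_mul I Y `<=` I.
Proof.
by apply: set_mul_min => [|u v|x y Ix _]; [apply: rideal0|apply: ridealD|apply: ridealM].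
Qed.

Lemma set_mul_ridealT I : set_mul I setT = I.
Proof.
apply/seteqP; split=> [|x Ix]; first exact: set_mul_ridealS.
by rewrite -[x]mulr1; apply: set_mul_in.
Qed.

(** For right ideals this says that the sum is R. Stating it for sets lets it apply to intersections
    without bundling them as ideals. *)
Definition comaximal X Y := exists x y, [/\ X x, Y y & 1 = x + y].

Lemma comaximal_sym X Y : comaximal X Y -> comaximal Y X.
Proof. by move=> [x [y [Xx Yy e]]]; exists y, x; rewrite addrC. Qed.

Lemma comaximalS X Y X' Y' : X `<=` X' -> Y `<=` Y' -> comaximal X Y -> comaximal X' Y'.
Proof. by move=> sX sY [x [y [/sX ? /sY ? ?]]]; exists x, y. Qed.

Lemma comaximal_subl I X : X `<=` I -> comaximal X I -> (I : set R) = setT.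
Proof. by move=> sXI [x [y [/sXI Ix Iy e]]]; apply: rideal_setT; rewrite e; apply: ridealD. Qed.

Lemma comaximal_comm_two_sided I J :
  comaximal J I -> set_mul I J = set_mul J I -> two_sided I.
Proof.
move=> [j [i [Jj Ii e]]] IJ a x Ix; rewrite -[a]mul1r e !mulrDl.
apply: ridealD; last by rewrite -mulrA; apply: ridealM.
apply: (@set_mul_ridealS I J); rewrite IJ.
by apply: set_mul_in => //; apply: ridealM.
Qed.

(** [K] is I + J, bundled so that it can be compared with other right ideals in a uniserial
    quotient. *)
Lemma rideal_sum_exists I J : exists K : rideal R,
  [/\ (I : set R) `<=` K, (J : set R) `<=` K & (K : set R) = setT -> comaximal I J].
Proof.
pose X : set R^c^o := [set z | exists x y : R, [/\ (I : set R) x, (J : set R) y & z = x + y]].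
have [||| K KE] := @submod_of_set R^c R^c^o X.
- by exists 0, 0; rewrite addr0; split=> //; apply: rideal0.
- move=> _ _ [x [y [Ix Jy ->]]] [x' [y' [Ix' Jy' ->]]].
  by exists (x + x'), (y + y'); split; [apply: ridealD|apply: ridealD|rewrite addrACA].
- move=> a _ [x [y [Ix Jy ->]]].
  exists (x * a), (y * a); split; [exact: ridealM|exact: ridealM|exact: mulrDl].
exists K; split=> [x Ix|y Jy|KT].
- by apply/KE; exists x, 0; rewrite addr0; split=> //; apply: rideal0.
- by apply/KE; exists 0, y; rewrite add0r; split=> //; apply: rideal0.
- by apply/KE; suff: rideal_set K 1 by []; rewrite KT.
Qed.

(** Correspondence theorem: right ideals above C are exactly the preimages of submodules of R/C. *)
Lemma uniserial_quotmod_chain C I J :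
    uniserial (quotmod C) -> (C : set R) `<=` I -> (C : set R) `<=` J ->
  (I : set R) `<=` J \/ (J : set R) `<=` I.
Proof.
move=> uC.
have lift (K : rideal R) : (C : set R) `<=` K ->
    exists N : submodClosed (quotmod C), forall x : R, \pi_(quotmod C) x \in N <-> (K : set R) x.
  move=> sCK; pose X := [set q : quotmod C | exists2 x : R, (K : set R) x & q = \pi_(quotmod C) x].
  have [||| N NE] := @submod_of_set R^c (quotmod C) X.
  - exists 0; [exact: rideal0 | exact/esym/(raddf0 (\pi_{ideal_quot (submod_mem C)}))].
  - move=> _ _ [x Kx ->] [y Ky ->]; exists (x + y); first exact: ridealD.
    by rewrite -(pi_quotmodD C x y).
  - move=> a _ [x Kx ->]; exists (x * a); first exact: ridealM.
    by rewrite -[LHS]pi_quotmodZ.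
  (* Two representatives of a class differ by an element of C, hence of [K], so membership does not
     depend on the representative. *)
  exists N => x; split=> [/NE[y Ky]|Kx]; last by apply/NE; exists x.
  by move/quotmodP => /sCK Kxy; rewrite -[x](subrK y); apply: ridealD.
move=> /lift[N NE] /lift[P PE].
by case: (uC N P) => sub; [left|right] => x; [move/NE/sub/PE|move/PE/sub/NE].
Qed.

(** * Families of two-sided right ideals *)

Section Families.
Variables (m : nat) (B_ : 'I_m -> rideal R).
Hypothesis B2 : forall j, two_sided (B_ j).

Lemma comaximal_bigcap C (P : set 'I_m) :
    (forall j, P j -> comaximal C (B_ j)) ->
  comaximal C (\bigcap_(j in P) (B_ j : set R)).
Proof.
move=> CB; pose s := [seq j <- enum 'I_m | `[<P j>]].
have {}CB : forall j, j \in s -> comaximal C (B_ j).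
  by move=> j; rewrite mem_filter => /andP[/asboolP/CB].
suff [c [b [Cc Bb e]]] : exists c b, [/\ (C : set R) c, forall j, j \in s -> (B_ j : set R) b & 1 = c + b].
  exists c, b; split=> // j Pj; apply: Bb.
  by rewrite mem_filter mem_enum andbT; apply/asboolP.
elim: s CB => [|j s IHs] CB.
  by exists 0, 1; rewrite add0r; split=> [|j|] //; first exact: rideal0.
have [k ks|c [b [Cc Bb e]]] := IHs; first by apply: CB; rewrite inE ks orbT.
have [c' [b' [Cc' Bb' e']]] := CB j (mem_head _ _).
(* Substituting 1 = c' + b' in front of b in 1 = c + b gives 1 = (c + c'b) + b'b; two-sidedness
   keeps b'b in the ideals that contain b. *)
exists (c + c' * b), (b' * b); split.
- by apply: ridealD => //; apply: ridealM.
- move=> k; rewrite inE => /predU1P[->|/Bb]; [exact: ridealM|exact: B2].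
- by rewrite -addrA -mulrDl -e' mul1r.
Qed.

Lemma bigcap_rideal_sub C :
    (forall j k, j <> k -> comaximal (B_ j) (B_ k)) ->
    uniserial (quotmod C) -> (C : set R) <> setT ->
    \bigcap_j (B_ j : set R) `<=` C ->
  exists j, (B_ j : set R) `<=` C.
Proof.
move=> Bco uC CnT sBC.
have [j nCj] : exists j, ~ comaximal C (B_ j).
  apply: contrapT => /forallNP nCB; apply: CnT.
  apply: comaximal_subl sBC _; apply/comaximal_sym/comaximal_bigcap => j _.
  exact: contrapT (nCB j).
(* C + B_j and C + B_k are comparable, since both lie above C. The larger one contains the comaximal
   pair B_j, B_k, so it is R. *)
have CB k : k <> j -> comaximal C (B_ k).
  move=> kj; apply: contrapT => nCk.
  have [J [sCJ sBJ Jco]] := rideal_sum_exists C (B_ j).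
  have [K [sCK sBK Kco]] := rideal_sum_exists C (B_ k).
  have Bkj := Bco _ _ kj.
  case: (uniserial_quotmod_chain uC sCJ sCK) => [sJK|sKJ].
    apply/nCk/Kco/(comaximal_subl (X := K)) => //.
    by apply: comaximalS (comaximal_sym Bkj); [move=> x /sBJ/sJK|].
  apply/nCj/Jco/(comaximal_subl (X := J)) => //.
  by apply: comaximalS Bkj; [move=> x /sBK/sKJ|].
exists j => b Bb.
have [c [d [Cc Bd e]]] := comaximal_bigcap (P := [set k | k <> j]) CB.
(* In b = cb + db, the term db lies in every B_k: through d when k differs from j, and through b, by
   two-sidedness, when k = j. *)
rewrite -[b]mul1r e mulrDl; apply: ridealD; first exact: ridealM.
apply: sBC => k _; have [->|/eqP kj] := eqVneq k j; first exact: B2.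
by apply: ridealM; apply: Bd.
Qed.

End Families.

(** * A serial factorization as an intersection *)

Section Serial.
Variables (A : rideal R) (n : nat) (A_ : 'I_n -> rideal R).

Lemma coindependent_comaximal i :
  coindependent A_ -> comaximal (A_ i) (\bigcap_(j in [set j | j <> i]) (A_ j : set R)).
Proof.
move=> [_ /(_ i) AT]; have : [set: R] 1 by [].
by rewrite -AT => -[x Ax [y Ay e]]; exists x, y.
Qed.

Lemma coindependent_comaximal2 i j :
  coindependent A_ -> i <> j -> comaximal (A_ i) (A_ j).
Proof.
move=> coA ij; apply: comaximalS (coindependent_comaximal i coA) => // x.
by apply => ji; apply: ij.
Qed.

(** Distinct members are comaximal, so an inclusion between them would make the larger one R. *)
Lemma coindependent_eq_of_sub i j :
  coindependent A_ -> (A_ i : set R) `<=` A_ j -> i = j.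
Proof.
move=> coA sij; apply: contrapT => ij; case: (coA) => /(_ j) AT _; apply: AT.
exact: comaximal_subl sij (coindependent_comaximal2 coA ij).
Qed.

Lemma serial_two_sided :
  serial_factorization A A_ -> (1 < n)%N -> forall i, two_sided (A_ i).
Proof.
move=> [_ coA comA _] n_gt1 i.
have [j ji] : exists j, j <> i.
  have /card_gt1P[x [y [_ _ xy]]] : (1 < #|'I_n|)%N by rewrite card_ord.
  have [xi|/eqP] := eqVneq x i; last by exists x.
  by exists y => yi; rewrite xi yi eqxx in xy.
exact: comaximal_comm_two_sided (coindependent_comaximal2 coA ji) (comA i j).
Qed.

Lemma bigprod_rideal_sub (s : seq 'I_n) i :
    (forall j, two_sided (A_ j)) -> i \in s ->
  \big[@set_mul R/setT]_(j <- s) (A_ j : set R) `<=` A_ i.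
Proof.
move=> A2; elim: s => // j s IHs; rewrite inE big_cons => /predU1P[->|/IHs sPA].
  exact: set_mul_ridealS.
apply: set_mul_min => [|u v|x y _ /sPA]; [exact: rideal0|exact: ridealD|exact: A2].
Qed.

Lemma bigprod_rideal_comm (s : seq 'I_n) i :
    (forall j, two_sided (A_ j)) ->
    (forall j k, set_mul (A_ j) (A_ k) = set_mul (A_ k) (A_ j)) ->
  set_mul (\big[@set_mul R/setT]_(j <- s) (A_ j : set R)) (A_ i) `<=`
  set_mul (A_ i) (\big[@set_mul R/setT]_(j <- s) (A_ j : set R)).
Proof.
move=> A2 comA; elim: s => [|j s IHs].
  (* For the empty product the claim is that R A_i lies in A_i, which is two-sidedness. *)
  rewrite big_nil set_mul_ridealT.
  apply: set_mul_min => [|u v|x y _]; [exact: rideal0|exact: ridealD|exact: A2].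
by rewrite big_cons -set_mulA [X in _ `<=` X]set_mulA -comA -set_mulA; apply: set_mulS.
Qed.

(** Let P be the product over the tail and 1 = a + p, with a in A_i and p in the other factors,
    hence in P by induction. In x = xa + xp, the term xp lies in A_i P, and xa lies in P A_i, which
    is contained in A_i P. *)
Lemma bigcap_sub_bigprod (s : seq 'I_n) :
    (forall j, two_sided (A_ j)) -> coindependent A_ ->
    (forall j k, set_mul (A_ j) (A_ k) = set_mul (A_ k) (A_ j)) -> uniq s ->
  \bigcap_(j in [set j | j \in s]) (A_ j : set R) `<=`
  \big[@set_mul R/setT]_(j <- s) (A_ j : set R).
Proof.
move=> A2 coA comA; elim: s => [|i s IHs] /=; first by rewrite big_nil.
move=> /andP[nis us] x Ax; rewrite big_cons.
have Aix : (A_ i : set R) x by apply: Ax; rewrite /= mem_head.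
have Px : (\big[@set_mul R/setT]_(j <- s) (A_ j : set R)) x.
  by apply: IHs => // j js; apply: Ax; rewrite /= inE js orbT.
have [a [p [Aa Ap e]]] := coindependent_comaximal i coA.
have Pp : (\big[@set_mul R/setT]_(j <- s) (A_ j : set R)) p.
  by apply: IHs => // j js; apply: Ap => ji; rewrite -ji js in nis.
rewrite -[x]mulr1 e mulrDr; apply: set_mulD; last exact: set_mul_in.
by apply: bigprod_rideal_comm => //; apply: set_mul_in.
Qed.

Lemma serial_bigcap :
  serial_factorization A A_ -> (A : set R) = \bigcap_i (A_ i : set R).
Proof.
move=> facA; have [-> coA comA _] := facA.
have [n_gt1|] := ltnP 1 n.
  have A2 := serial_two_sided facA n_gt1.
  apply/seteqP; split=> [x Px i _|x Ax].
    exact: bigprod_rideal_sub (mem_index_enum i) _ Px.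
  apply: bigcap_sub_bigprod => //; first exact: index_enum_uniq.
  by move=> i _; apply: Ax.
case: n A_ {facA coA comA} => [|[|//]] F _.
  by rewrite big_ord0; apply/seteqP; split=> // x _ [].
rewrite big_ord_recl big_ord0 set_mul_ridealT; apply/seteqP; split=> [x Fx i _|x]; last exact.
by rewrite ord1.
Qed.

End Serial.

(** * Comparison of two serial factorizations *)

Lemma serial_component_sub (A : rideal R) (n m : nat)
    (A_ : 'I_n -> rideal R) (B_ : 'I_m -> rideal R) :
    serial_factorization A A_ -> serial_factorization A B_ ->
  forall i, exists j, (B_ j : set R) `<=` A_ i.
Proof.
move=> facA facB i; have [_ [/(_ i) AnT _] _ /(_ i) uA] := facA.
have sBA : \bigcap_j (B_ j : set R) `<=` A_ i.
  by rewrite -(serial_bigcap facB) (serial_bigcap facA) => x; apply.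
have [m_gt1|] := ltnP 1 m.
  apply: bigcap_rideal_sub => //; first exact: serial_two_sided facB m_gt1.
  by case: facB => _ coB _ _ j k; apply: coindependent_comaximal2.
(* For m = 0 the empty intersection R would lie in the proper ideal A_i; for m = 1 the intersection
   is the only factor. *)
case: m B_ {facB} sBA => [|[|//]] B_ sBA _.
  by case: AnT; apply/rideal_setT/sBA => -[].
by exists ord0 => x Bx; apply: sBA => j _; rewrite ord1.
Qed.

Lemma serial_factorization_unique (A : rideal R) (n m : nat)
    (A_ : 'I_n -> rideal R) (B_ : 'I_m -> rideal R) :
    serial_factorization A A_ -> serial_factorization A B_ ->
  exists e : n = m, exists! s : 'S_n,
    forall i, (A_ i : set R) = (B_ (cast_ord e (s i)) : set R).
Proof.
move=> facA facB.
have [_ coA _ _] := facA; have [_ coB _ _] := facB.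
have [s sBA] := choice (serial_component_sub facA facB).
have [t tAB] := choice (serial_component_sub facB facA).
(* A_(t (s i)) lies in B_(s i), which lies in A_i; coindependence then identifies the indices. *)
have stK : cancel s t.
  by move=> i; apply: (coindependent_eq_of_sub coA) => x /tAB/sBA.
have tsK : cancel t s.
  by move=> j; apply: (coindependent_eq_of_sub coB) => x /sBA/tAB.
have nm : n = m.
  by rewrite -[n]card_ord -[m]card_ord; apply: bij_eq_card (Bijective stK tsK).
subst m; exists erefl, (perm (can_inj stK)); split=> [i|s' As'].
  rewrite cast_ord_id permE; apply/seteqP; split; last exact: sBA.
  by rewrite -{1}[i]stK; apply: tAB.
(* Any competitor s' satisfies A_i = B_(s' i), which contains B_(s i), so both indices agree. *)
apply/permP => i; rewrite permE; apply: (coindependent_eq_of_sub coB).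
by have := As' i; rewrite cast_ord_id => <-; apply: sBA.
Qed.

(** * Right chain quotient rings *)

Lemma quotring_right_chain (I : rideal R) (I2 : two_sided I) :
    (I : set R) <> setT -> uniserial (quotmod I) ->
  right_chain_ring (quotring I2).
Proof.
move=> InT uI; split.
  rewrite -[0](raddf0 (\pi_{ideal_quot (submod_mem I)})) => /(quotringP I2).
  by rewrite subr0 => I1; apply: InT; apply: rideal_setT.
(* R acts on R/I through the projection to the ring R/I, so right ideals of this ring are
   R-submodules with the same elements. *)
have descend (N : submodClosed (quotring I2)^c^o) :
    exists N' : submodClosed (quotmod I), forall q, q \in N' <-> (q : (quotring I2)^c^o) \in N.
  apply: (@submod_of_set R^c (quotmod I) [set q | (q : (quotring I2)^c^o) \in N]).
  - exact: (rpred0 N).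
  - exact: (@rpredD _ N).
  - move=> a q Nq; suff -> : a *: q = (\pi_(quotring I2) a : (quotring I2)^c) *: (q : (quotring I2)^c^o).
      exact: rpredZ.
    elim/quotW: q {Nq} => x; rewrite -[LHS]pi_quotmodZ; exact: (pi_quotringM I2 x a).
move=> N P; have [N' NE] := descend N; have [P' PE] := descend P.
by case: (uI N' P') => sub; [left|right] => q; [move/NE/sub/PE|move/PE/sub/NE].
Qed.

(** * The Chinese remainder isomorphism *)

Section ChineseRemainder.
Variables (A : rideal R) (n : nat) (A_ : 'I_n -> rideal R).
Hypotheses (A2 : two_sided A) (A_2 : forall i, two_sided (A_ i)).
Hypothesis AE : (A : set R) = \bigcap_i (A_ i : set R).
Arguments A_2 : clear implicits.

Definition quotring_diag (q : quotring A2) : ring_prod (fun i => quotring (A_2 i)) :=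
  [ffun i => \pi_(quotring (A_2 i)) (repr q : R)].

(** The representative chosen in [quotring_diag] differs from r by an element of A, which lies in
    A_i. *)
Lemma quotring_diag_pi (r : R) i :
  quotring_diag (\pi_(quotring A2) r) i = \pi_(quotring (A_2 i)) r.
Proof.
rewrite ffunE; apply/quotringP.
have : (A : set R) ((repr (\pi_(quotring A2) r) : R) - r) by exact/quotringP/reprK.
by rewrite AE; apply.
Qed.

Lemma quotring_diag_zmod_morphism : zmod_morphism quotring_diag.
Proof.
elim/quotW => x; elim/quotW => y; apply/ffunP => i.
rewrite -[X in quotring_diag X](raddfB (\pi_{ideal_quot (submod_mem A)})).
rewrite [RHS]ffunE [X in _ = _ + X]ffunE !quotring_diag_pi.
exact: (raddfB (\pi_{ideal_quot (submod_mem (A_ i))})).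
Qed.

Lemma quotring_diag_monoid_morphism : monoid_morphism quotring_diag.
Proof.
split=> [|q r]; first by apply/ffunP => i; rewrite quotring_diag_pi ffunE.
elim/quotW: q => x; elim/quotW: r => y; apply/ffunP => i.
by rewrite -[X in quotring_diag X](pi_quotringM A2) [RHS]ffunE !quotring_diag_pi pi_quotringM.
Qed.

Lemma quotring_diag_inj : injective quotring_diag.
Proof.
elim/quotW => x; elim/quotW => y /ffunP xy; apply/quotringP.
suff : (A : set R) (x - y) by [].
rewrite AE => i _; apply/(quotringP (A_2 i)).
by have := xy i; rewrite !quotring_diag_pi.
Qed.

Lemma quotring_diag_bij : coindependent A_ -> bijective quotring_diag.
Proof.
move=> coA.
(* The element c lifts the i-th coordinate idempotent: it is 1 modulo A_i and 0 modulo the other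
   factors. *)
have lift_idem i : exists c : R,
    (forall j, j <> i -> (A_ j : set R) c) /\ (A_ i : set R) (1 - c).
  have [a [c [Aa Ac ->]]] := coindependent_comaximal i coA.
  by exists c; rewrite addrK.
have [c cP] := choice lift_idem.
pose g (h : ring_prod (fun i => quotring (A_2 i))) : quotring A2 :=
  \pi_(quotring A2) (\sum_i c i * (repr (h i) : R)).
have gK : cancel g quotring_diag.
  move=> h; apply/ffunP => i; rewrite quotring_diag_pi -[RHS]reprK; apply/quotringP.
  set r := fun j => (repr (h j) : R).
  suff : (A_ i : set R) (\sum_j c j * r j - r i) by [].
  (* Modulo A_i only the i-th term survives, and it differs from r_i by -(1 - c_i) r_i. *)
  rewrite (bigD1 i) //= addrAC -[X in _ - X]mul1r -mulrBl -opprB.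
  apply: ridealD; first exact/ridealM/ridealN/(cP i).2.
  elim/big_ind: _ => [|u v|j /eqP ji]; [exact: rideal0|exact: ridealD|].
  by apply/ridealM/(cP j).1 => /esym.
by exists g => //; apply: (inj_can_sym gK); apply: quotring_diag_inj.
Qed.

HB.instance Definition _ := GRing.isZmodMorphism.Build
  (quotring A2) (ring_prod (fun i => quotring (A_2 i))) quotring_diag
  quotring_diag_zmod_morphism.
HB.instance Definition _ := GRing.isMonoidMorphism.Build
  (quotring A2) (ring_prod (fun i => quotring (A_2 i))) quotring_diag
  quotring_diag_monoid_morphism.

Definition quotring_diag_rmorphism :
    {rmorphism quotring A2 -> ring_prod (fun i => quotring (A_2 i))} :=
  quotring_diag.

End ChineseRemainder.
End RightIdeals.

Theorem theorem2p8 (R : nzRingType) (A : rideal R) (n m : nat)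
    (A_ : 'I_n -> rideal R) (B_ : 'I_m -> rideal R)
    (facA : serial_factorization A A_) (facB : serial_factorization A B_) :
  (exists e : n = m, exists! s : 'S_n,
     forall i, (A_ i : set R) = (B_ (cast_ord e (s i)) : set R)) /\
  ((2 <= n)%N ->
   exists (A2 : two_sided A) (A_2 : forall i, two_sided (A_ i)),
     (exists f : {rmorphism quotring A2 -> ring_prod (fun i => quotring (A_2 i))},
        bijective f /\
        forall (r : R) (i : 'I_n), f (\pi_(quotring A2) r) i = \pi_(quotring (A_2 i)) r) /\
     (forall i, right_chain_ring (quotring (A_2 i)))).
Proof.
split=> [|n_gt1]; first exact: serial_factorization_unique facA facB.
have A_2 := serial_two_sided facA n_gt1; have AE := serial_bigcap facA.
have [_ coA _ uA] := facA.
have A2 : two_sided A.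
  by move=> a x; rewrite AE => Ax i _; apply/A_2/Ax.
exists A2, A_2; split=> [|i].
  exists (quotring_diag_rmorphism A2 A_2 AE); split; first exact: quotring_diag_bij.
  exact: quotring_diag_pi.
by apply: quotring_right_chain (uA i); case: coA.
Qed.
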